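(* Let $S$ be a cancellative commutative locally compact pseudocompact Hausdorff topological semigroup with open shifts, and let $K$ be a subsemigroup of $S$. Then the closure $\mathrm{Cl}_S(K)$ of $K$ in $S$ can be embedded as a dense open subsemigroup into a compact Hausdorff topological group; that is, there exist a compact Hausdorff topological group $G$ and an injective homomorphism $j\colon \mathrm{Cl}_S(K)\to G$ that is a homeomorphism onto its image (with $\mathrm{Cl}_S(K)$ carrying the subspace topology from $S$), such that $j(\mathrm{Cl}_S(K))$ is open and dense in $G$.
   Context: A topological semigroup is a nonempty set $S$ with an associative operation and a topology such that the operation $S\times S\to S$ is jointly continuous. It has open shifts if for every $a\in S$ and every open $U\subseteq S$ the sets $aU$ and $Ua$ are open in $S$. A space is locally compact if each point has a compact neighborhood. A (Tychonoff) space is pseudocompact if every continuous real-valued function on it is bounded. Subsemigroups are nonempty. *)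

(* Defs.v *)
From HB Require Import structures.
From mathcomp Require Import all_boot all_order all_algebra.
From mathcomp Require Import all_classical all_reals all_analysis.
Import numFieldNormedType.Exports.
Set Implicit Arguments.
Unset Strict Implicit.
Unset Printing Implicit Defensive.

Local Open Scope classical_set_scope.
Local Open Scope group_scope.

HB.mixin Record isTopologicalSemigroup S of Semigroup S & Topological S := {
  semigroup_nonempty : [set: S] !=set0 ;
  mulg_continuous : continuous (fun x : S * S => x.1 * x.2)
}.

#[short(type="topologicalSemigroupType")]
HB.structure Definition TopologicalSemigroup :=
  {S of Semigroup S & Topological S & isTopologicalSemigroup S}.

HB.mixin Record isTopologicalGroup G of Group G & Topological G := {
  invg_continuous : continuous (fun x : G => x^-1)
}.

#[short(type="topologicalGroupType")]
HB.structure Definition TopologicalGroup :=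
  {G of Group G & TopologicalSemigroup G & isTopologicalGroup G}.

Definition cancellative (S : magmaType) : Prop :=
  forall a b c : S, (a * b = a * c -> b = c) /\ (b * a = c * a -> b = c).

Definition open_shifts (S : topologicalSemigroupType) : Prop :=
  forall (a : S) (U : set S), open U ->
    open [set a * x | x in U] /\ open [set x * a | x in U].

Definition pseudocompact (R : realType) (X : topologicalType) : Prop :=
  forall f : X -> R, continuous f -> bounded_fun f.

Record subsemigroup (S : topologicalSemigroupType) := Subsemigroup {
  subsemigroup_set :> set S;
  subsemigroup_nonempty : subsemigroup_set !=set0;
  subsemigroup_mul : forall x y,
    subsemigroup_set x -> subsemigroup_set y -> subsemigroup_set (x * y)
}.

Section SubsemigroupType.
Variables (S : topologicalSemigroupType) (K : subsemigroup S).

Definition subsemigroup_op (x y : set_type K) : set_type K :=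
  SigSub (mem_set (subsemigroup_mul (set_valP x) (set_valP y))).

Fact subsemigroup_opA : associative subsemigroup_op.
Proof. by move=> x y z; apply: val_inj; rewrite /= mulgA. Qed.

HB.instance Definition _ :=
  isSemigroup.Build (set_type K) subsemigroup_opA.

Fact subsemigroup_type_nonempty : [set: set_type K] !=set0.
Proof.
by have [x Kx] := subsemigroup_nonempty K; exists (SigSub (mem_set Kx)).
Qed.

Fact subsemigroup_mulg_continuous :
  continuous (fun x : set_type K * set_type K => x.1 * x.2).
Proof.
apply: continuous_comp_initial => -[x y].
have cval : continuous (set_val : set_type K -> S).
  exact: initial_continuous.
apply: (@continuous_comp _ _ _
  (fun p : set_type K * set_type K => (set_val p.1, set_val p.2))
  (fun p : S * S => p.1 * p.2)); last exact: mulg_continuous.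
apply: cvg_pair.
- by apply: (cvg_comp _ _ cvg_fst); exact: cval.
- by apply: (cvg_comp _ _ cvg_snd); exact: cval.
Qed.

HB.instance Definition _ := isTopologicalSemigroup.Build (set_type K)
  subsemigroup_type_nonempty subsemigroup_mulg_continuous.

End SubsemigroupType.

Section ClosureSubsemigroup.
Variables (S : topologicalSemigroupType) (K : subsemigroup S).

Fact closure_nonempty : closure K !=set0.
Proof.
by have [x Kx] := subsemigroup_nonempty K; exists x; exact: subset_closure.
Qed.

Fact closure_mul (x y : S) : closure K x -> closure K y -> closure K (x * y).
Proof.
move=> clx cly W /(mulg_continuous (x, y)) [[U V]] /= [Ux Vy] UVW.
have [a [Ka Ua]] := clx _ Ux; have [b [Kb Vb]] := cly _ Vy.
exists (a * b); split; first exact: subsemigroup_mul.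
exact: (UVW (a, b)).
Qed.

Definition closure_subsemigroup : subsemigroup S :=
  Subsemigroup closure_nonempty closure_mul.

End ClosureSubsemigroup.

Definition homeo_onto_image (X Y : topologicalType) (f : X -> Y) : Prop :=
  [/\ injective f, continuous f &
      forall U : set X, open U -> open (f @` U : set (subspace (range f)))].

(* Main.v *)
Require Import Defs.
From HB Require Import structures.
From mathcomp Require Import all_boot all_order all_algebra.
From mathcomp Require Import all_classical all_reals all_analysis.
Import numFieldNormedType.Exports.
Import Order.TTheory GRing.Theory Num.Theory.

Set Implicit Arguments.
Unset Strict Implicit.
Unset Printing Implicit Defensive.

Local Open Scope classical_set_scope.
Local Open Scope group_scope.

(** Being commutative and cancellative, S embeds in its group of fractions G.
    Give G the final topology for the maps x |-> x / a.  Open shifts say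
    exactly that the embedding of S is then open, so that near each point G
    looks like S: it is Hausdorff, it has a compact neighbourhood of 1, and its
    multiplication is jointly continuous.  That inversion is continuous too is
    not formal (under addition, and with the topology generated by the intervals
    a <= x < b, the positive reals have open shifts, but the inversion of their
    group of fractions is discontinuous); local compactness forces it, by a
    theorem of Ellis ([inverse_continuous]).

    Now S is an open subsemigroup of the topological group G.  If finitely many
    translates of some neighbourhood of 1 never covered S, a sequence of points
    of S could be chosen with translates of a smaller neighbourhood forming a
    discrete family, and a locally finite sum of bump functions would be
    continuous and unbounded on S.  So pseudocompactness makes S totally
    bounded in G ([pseudocompact_totally_bounded]), and since G is locally
    compact the closure of S in G is compact
    ([pseudocompact_image_precompact]).

    The closure H of K in G is therefore a compact subsemigroup of G, and such
    a subsemigroup is a subgroup: powers of x accumulate, so x^-1 is a limit of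
    powers of x ([compact_subsemigroup_inv]).  As S is open in G, the closure
    of K in S is the trace of H on S, hence open in H, and it is dense in H
    because it contains K. *)

(** * Topological semigroups *)

Lemma mulg_left_continuous (S : topologicalSemigroupType) (a : S) :
  continuous (fun x : S => a * x).
Proof.
move=> x; apply: (@continuous_comp _ _ _ (fun y : S => (a, y))
  (fun p : S * S => p.1 * p.2)); last exact: mulg_continuous.
by apply: cvg_pair; [exact: cvg_cst|exact: cvg_id].
Qed.

Lemma mulg_right_continuous (S : topologicalSemigroupType) (a : S) :
  continuous (fun x : S => x * a).
Proof.
move=> x; apply: (@continuous_comp _ _ _ (fun y : S => (y, a))
  (fun p : S * S => p.1 * p.2)); last exact: mulg_continuous.
by apply: cvg_pair; [exact: cvg_id|exact: cvg_cst].
Qed.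

Lemma nbhs_mulg (S : topologicalSemigroupType) (a b : S) (W : set S) :
  nbhs (a * b) W -> exists U V, [/\ nbhs a U, nbhs b V &
    forall x y, U x -> V y -> W (x * y)].
Proof.
move=> /(mulg_continuous (a, b)) [[U V]] /= [Ua Vb] UVW.
by exists U, V; split=> // x y Ux Vy; exact: (UVW (x, y)).
Qed.

(** A sequential form of compactness, shared by the two arguments below that
    iterate a product and compare its values at two late stages. *)
Lemma compact_seq_cluster (T : topologicalType) (C : set T) (x : nat -> T) :
  compact C -> (forall n, C (x n)) ->
  exists p : T, forall W, nbhs p W -> forall N, exists2 n, (N <= n)%N & W (x n).
Proof.
move=> cC Cx.
have [p [_ clp]] : C `&` cluster (x @ \oo) !=set0.
  by apply: cC; exists 0%N => // n _; exact: Cx.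
exists p => W Wp N.
have [|_ [[n Nn <-] Wn]] := clp [set x n | n in [set n | (N <= n)%N]] W _ Wp;
  last by exists n.
by exists N => // n /= Nn; exists n.
Qed.

(** * Continuity of the inverse *)

Section Ellis.
(* The inverse is an explicit operation, of which no continuity is assumed. *)
Variables (G : topologicalSemigroupType) (e : G) (inv : G -> G).
Hypothesis mul1 : left_id e ( *%g : G -> G -> G).
Hypothesis mule : right_id e ( *%g : G -> G -> G).
Hypothesis mulV : left_inverse e inv ( *%g : G -> G -> G).
Hypothesis mulIV : right_inverse e inv ( *%g : G -> G -> G).

Let inv_eq a b : a * b = e -> inv a = b.
Proof. by move=> ab; rewrite -[inv a]mule -ab mulgA mulV mul1. Qed.

Let nbhs_shift a b (W : set G) : nbhs (a * b) W -> nbhs b [set x | W (a * x)].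
Proof. exact: (@mulg_left_continuous G a b). Qed.

(** Suppose that x_n tends to e so fast that the tails y_n^-1 y_m of the partial
    products stay small, while the inverses of the x_n stay outside U.  The y_n
    remain in the compact set C, so they accumulate at some p.  Then
    y_(n+1)^-1 p is small as a limit of tails, and p^-1 y_n is small for
    suitable n, so their product, which is the inverse of the factor between
    y_n and y_(n+1), lies in U after all. *)
Lemma inverse_continuous_at_unit (C : set G) : hausdorff_space G ->
  compact C -> nbhs e C -> forall U, nbhs e U -> nbhs e (inv @^-1` U).
Proof.
move=> hG cC Ce U Ue.
(* Regularity at e gives the closures, joint continuity the products. *)
have /choice[shrink shrinkP] : forall V : set G, exists V' : set G,
    nbhs e V -> [/\ nbhs e V', closure V' `<=` V &
                    forall a b, V' a -> V' b -> V (a * b)].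
  move=> V.
  have [Ve|nVe] := pselect (nbhs e V); last by exists V.
  have [A Ae AV] := compact_regular hG cC Ce Ve.
  have [] := @nbhs_mulg G e e V; first by rewrite mul1.
  move=> B [D [Be De BDV]]; exists (A `&` (B `&` D)) => _; split.
  - by apply: filterI => //; exact: filterI.
  - by apply: subset_trans AV; apply: closureS => x [].
  - by move=> a b [_ [Ba _]] [_ [_ Db]]; exact: BDV.
apply: contrapT => nU.
pose V n := iter n shrink (U `&` C).
have Ve n : nbhs e (V n).
  by elim: n => [|n IH]; [exact: filterI|by have [] := shrinkP _ IH].
have VS n : closure (V n.+1) `<=` V n by have [] := shrinkP _ (Ve n).
have VM n a b : V n.+1 a -> V n.+1 b -> V n (a * b).
  by have [_ _] := shrinkP _ (Ve n); apply.
have VS' n : V n.+1 `<=` V n by apply: subset_trans (VS n); exact: subset_closure.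
have V1 n : V n.+1 `<=` V 1%N.
  by elim: n => // n IH; apply: subset_trans IH; exact: VS'.
have /choice[x xP] : forall n, exists x, V n x /\ ~ U (inv x).
  move=> n; apply: contrapT => /forallNP nx; apply: nU.
  apply: filterS (Ve n) => z Vz; apply: contrapT => nz; exact: (nx z).
(* The factor added at stage n is x_(n+2), so that the tail from n on, whose
   first factor is taken in V (n+2), fits in V (n+1). *)
pose y := fix y n := if n is m.+1 then y m * x m.+2 else e.
have yS n : y n.+1 = y n * x n.+2 by [].
have ytail k : forall n, V n.+1 (inv (y n) * y (n + k)%N).
  elim: k => [|k IH] n.
    by rewrite addn0 mulV; exact: nbhs_singleton.
  have -> : inv (y n) * y (n + k.+1)%N = x n.+2 * (inv (y n.+1) * y (n.+1 + k)%N).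
    rewrite addSnnS mulgA; congr (_ * _).
    have -> : inv (y n.+1) = inv (x n.+2) * inv (y n).
      apply: inv_eq; rewrite yS -mulgA (mulgA (x _)) mulIV mul1; exact: mulIV.
    by rewrite mulgA mulIV mul1.
  by apply: VM; [exact: (xP _).1|exact: IH].
have inve : inv e = e by apply: inv_eq; rewrite mul1.
have [n|p clp] := @compact_seq_cluster G C y cC.
  have /VS'[] : V 1%N (y n); last by [].
  by have := ytail n 0; rewrite /= inve mul1 add0n.
have pV n : V n (inv (y n) * p).
  apply: VS => W /nbhs_shift /clp /(_ n)[m nm Wm].
  exists (inv (y n) * y m); split=> //.
  by rewrite -(subnKC nm); exact: ytail.
have [n n0 Vn] : exists2 n, (0 < n)%N & V 1%N (inv p * y n).
  have /nbhs_shift/clp/(_ 1%N)[n n0 Vn] : nbhs (inv p * p) (V 1%N) by rewrite mulV.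
  by exists n.
case: (xP n.+2) => _; apply.
have -> : inv (x n.+2) = (inv (y n.+1) * p) * (inv p * y n).
  apply: inv_eq.
  rewrite -mulgA (mulgA p) mulIV mul1 mulgA yS.
  have -> : inv (y n * x n.+2) = inv (x n.+2) * inv (y n).
    apply: inv_eq; rewrite -mulgA (mulgA (x _)) mulIV mul1; exact: mulIV.
  by rewrite mulgA mulIV mul1 mulV.
suff [//] : (U `&` C) (inv (y n.+1) * p * (inv p * y n)).
by apply: (VM 0%N) => //; apply: (V1 n); exact: pV.
Qed.

Lemma inverse_continuous (C : set G) : hausdorff_space G ->
  compact C -> nbhs e C -> continuous inv.
Proof.
move=> hG cC Ce a W Wa.
have Ue : nbhs e [set z | W (z * inv a)].
  by apply: mulg_right_continuous; rewrite mul1.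
have := inverse_continuous_at_unit hG cC Ce Ue.
rewrite -{1}(mulV a) => /nbhs_shift; apply: filterS => z /=.
rewrite (_ : inv (inv a * z) = inv z * a).
  by rewrite -mulgA mulIV mule.
by apply: inv_eq; rewrite -mulgA (mulgA z) mulIV mul1 mulV.
Qed.
End Ellis.

(** * Compact subsemigroups *)

(** If x^(n+1) and x^(m+1) are both close to a cluster point of the powers of
    x, then x^(m-n) is close to 1, so x^(m-n-1) is close to x^-1.  Taking
    m >= n+2 keeps this exponent positive, hence the power inside C. *)
Lemma compact_subsemigroup_inv (G : topologicalGroupType) (C : set G) :
  compact C -> closed C -> (forall x y, C x -> C y -> C (x * y)) ->
  forall x, C x -> C x^-1.
Proof.
move=> cC clC CM x Cx; apply: clC => N Nx.
have CX n : C (x ^+ n.+1).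
  by elim: n => // n IH; rewrite expgS; exact: CM.
have [p clp] := compact_seq_cluster cC CX.
have [A [B [Ap Bp ABN]]] : exists A B, [/\ nbhs p A, nbhs p B &
    forall a b, A a -> B b -> N (x^-1 * (a^-1 * b))].
  have : nbhs (p^-1 * p) [set z | N (x^-1 * z)].
    by apply: mulg_left_continuous; rewrite mulVg mulg1.
  move=> /nbhs_mulg[A [B [Ap Bp AB]]].
  exists [set z | A z^-1], B; split=> //; first exact: invg_continuous.
  by move=> a b; exact: AB.
have [n _ An] := clp _ Ap 0%N.
have [m nm Bm] := clp _ Bp n.+2.
have := ABN _ _ An Bm.
exists (x ^+ (m - n.+2).+1); split; first exact: CX.
have mE : m.+1 = (n.+1 + (1 + (m - n.+2).+1))%N.
  by rewrite -[in LHS](subnKC nm) !addnS addSn addSn.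
by move: H; rewrite mE expgnDr mulKg expgnDr expg1 mulKg.
Qed.

(** * Pseudocompactness and total boundedness *)

(** Otherwise a function equal to n at x n could be built by gluing bump
    functions supported in the O n: locally at most one of them is nonzero. *)
Lemma pseudocompact_no_discrete_family (R : realType) (X : topologicalType)
    (x : nat -> X) (O : nat -> set X) :
  completely_regular_space X -> pseudocompact R X ->
  (forall n, open (O n)) -> (forall n, O n (x n)) ->
  ~ (forall y : X, exists2 N, nbhs y N &
       forall m n, N `&` O m !=set0 -> N `&` O n !=set0 -> m = n).
Proof.
move=> crX psX oO Ox disc.
have /choice[phi phiP] : forall n, exists phi : X -> R,
    [/\ continuous phi, phi (x n) = 1%R & forall z, ~ O n z -> phi z = 0%R].
  move=> n; have cO : closed (~` O n) by exact: open_closedC.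
  have nx : ~ (~` O n) (x n) by apply; exact: Ox.
  have /(uniform_separatorP (R := R))[f [cf _ f0 f1]] := crX _ _ cO nx.
  exists (fun z => (1 - f z)%R); split.
  - by move=> z; apply: cvgB; [exact: cvg_cst|exact: cf].
  - by rewrite (f0 (f (x n))) ?subr0//; exists (x n).
  - by move=> z Oz; rewrite (f1 (f z)) ?subrr//; exists z.
pose g y : R := if pselect (exists n, O n y) is left h
  then ((projT1 (cid h))%:R * phi (projT1 (cid h)) y)%R else 0%R.
have gE n y : O n y -> g y = (n%:R * phi n y)%R.
  rewrite /g => Oy; case: pselect => [h|]; last by case; exists n.
  case: cid => m /= Om; have [N /nbhs_singleton Ny NO] := disc y.
  by rewrite (NO m n) //; exists y.
have g0 y : (forall n, ~ O n y) -> g y = 0%R.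
  by rewrite /g => nO; case: pselect => // -[n On]; case: (nO n).
have local_cvg (h : X -> R) y : continuous h -> h y = g y ->
    {near nbhs y, h =1 g} -> g @ y --> g y.
  move=> ch hy hg; apply: (cvg_trans (near_eq_cvg hg)).
  by rewrite -hy; exact: ch.
have cg : continuous g.
  move=> y; have [N Ny NO] := disc y.
  have [[n [z [Nz Oz]]]|noN] := pselect (exists n, N `&` O n !=set0).
    have gN t : N t -> (n%:R * phi n t)%R = g t.
      move=> Nt; have [[m Om]|nO] := pselect (exists m, O m t).
        by rewrite (NO n m) ?(gE m)//; [exists z|exists t].
      rewrite g0; last by move=> m Om; apply: nO; exists m.
      have [_ _ ->] := phiP n; rewrite ?mulr0// => On; by apply: nO; exists n.
    apply: (@local_cvg (fun t => n%:R * phi n t)%R).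
    - move=> t; apply: cvgM; [exact: cvg_cst|by have [+ _ _] := phiP n; apply].
    - by apply: gN; exact: nbhs_singleton.
    - exact: filterS gN Ny.
  have gN t : N t -> 0%R = g t.
    by move=> Nt; rewrite g0// => n On; apply: noN; exists n, t.
  apply: (@local_cvg (fun=> 0%R)); first by move=> t; exact: cvg_cst.
    by apply: gN; exact: nbhs_singleton.
  exact: filterS gN Ny.
have [M [_ /(_ (M + 1)%R)]] := psX g cg.
rewrite ltrDl ltr01 => /(_ isT) gM.
have /= := gM (x (Num.truncn (M + 1)%R).+1) I; rewrite (gE (Num.truncn (M + 1)%R).+1)//.
have [_ -> _] := phiP (Num.truncn (M + 1)%R).+1.
rewrite mulr1 ger0_norm // leNgt truncnS_gt //.
Qed.

(** If no finite set of translates suffices, a greedy choice gives a sequence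
    with (f x_m)^-1 (f x_n) outside U for all m < n.  For W small with respect
    to U, the translates of W around the f x_n then form a discrete family: a
    translate of W that met two of them would bring their centres U-close. *)
Lemma pseudocompact_totally_bounded (R : realType) (X : topologicalType)
    (G : topologicalGroupType) (f : X -> G) :
  completely_regular_space X -> pseudocompact R X -> continuous f ->
  forall U : set G, nbhs 1 U ->
    exists s : seq X, forall x, exists2 a, a \in s & U ((f a)^-1 * f x).
Proof.
move=> crX psX cf U U1; apply: contrapT => nos.
have /choice[next nextP] : forall s : seq X, exists x,
    forall a, a \in s -> ~ U ((f a)^-1 * f x).
  move=> s; apply: contrapT => /forallNP nx; apply: nos; exists s => x.
  apply: contrapT => nU; apply: (nx x) => a a_s Ua; apply: nU; by exists a.
pose prefix := fix prefix n :=
  if n is m.+1 then next (prefix m) :: prefix m else [::].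
pose x n := next (prefix n).
have xU m n : (m < n)%N -> ~ U ((f (x m))^-1 * f (x n)).
  move=> mn; apply: nextP.
  elim: n mn => // n IH; rewrite ltnS leq_eqVlt in_cons.
  by case/predU1P => [->|/IH ->]; rewrite ?eqxx ?orbT.
(* W W^-1 W W^-1 is contained in U, by halving U twice. *)
have [W oW1 WU] : exists2 W : set G, open_nbhs 1 W &
    forall a b c d, W a -> W b -> W c -> W d -> U ((a * b^-1) * (c * d^-1)).
  have [A [B [A1 B1 AB]]] : exists A B : set G, [/\ nbhs 1 A, nbhs 1 B &
      forall x y, A x -> B y -> U (x * y)] by apply: nbhs_mulg; rewrite mulg1.
  have [C [D [C1 D1 CD]]] : exists C D : set G, [/\ nbhs 1 C, nbhs 1 D &
      forall x y, C x -> D y -> (A `&` B) (x * y)].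
    by apply: nbhs_mulg; rewrite mulg1; exact: filterI.
  have D'1 : nbhs (1 : G) [set z | D z^-1] by apply: invg_continuous; rewrite invg1.
  have : nbhs (1 : G) (C `&` [set z | D z^-1]) by exact: filterI.
  rewrite nbhsE => -[W oW1 WCD]; exists W => // a b c d Wa Wb Wc Wd.
  by apply: AB; [case: (CD a b^-1) | case: (CD c d^-1)] => //;
    [case: (WCD a)|case: (WCD b)|case: (WCD c)|case: (WCD d)].
pose O n := f @^-1` [set z | W ((f (x n))^-1 * z)].
apply: (@pseudocompact_no_discrete_family R X x O) => // [n|n|y].
- apply: open_comp => [z _|]; first exact: cf.
  apply: (@open_comp _ _ (fun z => (f (x n))^-1 * z)); last exact: oW1.1.
  by move=> z _; exact: mulg_left_continuous.
- by rewrite /O /= mulVg; exact: oW1.2.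
exists (f @^-1` [set z | W ((f y)^-1 * z)]).
  apply: cf; apply: mulg_left_continuous; rewrite mulVg.
  exact: open_nbhs_nbhs.
have key m n : (m < n)%N -> f @^-1` [set z | W ((f y)^-1 * z)] `&` O m !=set0 ->
    f @^-1` [set z | W ((f y)^-1 * z)] `&` O n !=set0 -> False.
  move=> mn [s [/= sy sm]] [t [/= ty tn]]; apply: (xU m n mn).
  have := WU _ _ _ _ sm sy ty tn.
  by rewrite !invgM !invgK !mulgA !mulgK.
move=> m n Nm Nn; have [mn|nm|//] := ltngtP m n; first by case: (key m n).
by case: (key n m).
Qed.

Lemma pseudocompact_image_precompact (R : realType) (X : topologicalType)
    (G : topologicalGroupType) (f : X -> G) (C : set G) :
  completely_regular_space X -> pseudocompact R X -> continuous f ->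
  hausdorff_space G -> compact C -> nbhs 1 C -> compact (closure (range f)).
Proof.
move=> crX psX cf hG cC C1.
have [s sP] := pseudocompact_totally_bounded crX psX cf C1.
rewrite -precompactE.
pose D := \big[setU/set0]_(a <- s) [set f a * z | z in C].
have cD : compact D.
  apply: bigsetU_compact => a _; apply: continuous_compact => //.
  by apply: continuous_subspaceT; exact: mulg_left_continuous.
apply: precompact_subset (compact_precompact hG cD) => _ [x _ <-].
have [a a_s Ca] := sP x.
rewrite /D -bigcup_seq; exists a => //; exists ((f a)^-1 * f x) => //.
by rewrite mulVKg.
Qed.

(** * Subgroups of topological groups *)

Record subgroup_of (G : topologicalGroupType) := SubgroupOf {
  subgroup_subsemigroup :> subsemigroup G;
  subgroup_one : subsemigroup_set subgroup_subsemigroup 1;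
  subgroup_inv : forall x, subsemigroup_set subgroup_subsemigroup x ->
    subsemigroup_set subgroup_subsemigroup x^-1
}.

Section SubgroupType.
Variables (G : topologicalGroupType) (H : subgroup_of G).
Local Notation T := (set_type H).

Definition subgroup_unit : T := SigSub (mem_set (subgroup_one H)).
Definition subgroup_opp (x : T) : T :=
  SigSub (mem_set (subgroup_inv (set_valP x))).

Fact subgroup_mul1g : left_id subgroup_unit ( *%g : T -> T -> T).
Proof. by move=> x; apply: val_inj; rewrite /= mul1g. Qed.
Fact subgroup_mulg1 : right_id subgroup_unit ( *%g : T -> T -> T).
Proof. by move=> x; apply: val_inj; rewrite /= mulg1. Qed.
Fact subgroup_mulVg : left_inverse subgroup_unit subgroup_opp ( *%g : T -> T -> T).
Proof. by move=> x; apply: val_inj; rewrite /= mulVg. Qed.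
Fact subgroup_mulgV : right_inverse subgroup_unit subgroup_opp ( *%g : T -> T -> T).
Proof. by move=> x; apply: val_inj; rewrite /= mulgV. Qed.

HB.instance Definition _ := Magma_isUMagma.Build T subgroup_mul1g subgroup_mulg1.
HB.instance Definition _ := hasInv.Build T subgroup_opp.
HB.instance Definition _ := Monoid_isGroup.Build T subgroup_mulVg subgroup_mulgV.

Fact subgroup_inv_continuous : continuous (fun x : T => x^-1).
Proof.
apply: continuous_comp_initial => x.
apply: (@continuous_comp _ _ _ (set_val : T -> G) (fun x : G => x^-1)).
  exact: initial_continuous.
exact: invg_continuous.
Qed.
HB.instance Definition _ := isTopologicalGroup.Build T subgroup_inv_continuous.
End SubgroupType.


(** * The group of fractions *)

(** The hypotheses under which fractions form a topological group are bundled
    so that the type of fractions, which depends on a proof of them, carries its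
    structures canonically. *)
Record lc_open_shift (S : topologicalSemigroupType) : Prop := LcOpenShift {
  losC : forall x y : S, x * y = y * x;
  los_cancel : cancellative S;
  los_shifts : open_shifts S;
  los_hausdorff : hausdorff_space S;
  los_lcompact : locally_compact [set: S]
}.

Lemma mulgACA_commutative (S : semigroupType)
    (mulC : forall x y : S, x * y = y * x) (a b c d : S) :
  a * b * (c * d) = a * c * (b * d).
Proof. by rewrite -!mulgA (mulgA b) (mulC b c) -mulgA. Qed.

Section Fractions.
Local Open Scope quotient_scope.
Variables (S : topologicalSemigroupType) (hS : lc_open_shift S).
Implicit Types a b c d x y : S.

Let mulC := losC hS.
Let mulI a : injective (fun x => a * x).
Proof. by move=> b c; apply: (proj1 (los_cancel hS a b c)). Qed.

Let mulACA a b c d : (a * b) * (c * d) = (a * c) * (b * d).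
Proof. exact: mulgACA_commutative mulC a b c d. Qed.

Definition frac_rel : rel (S * S) := fun p q => `[< p.1 * q.2 = q.1 * p.2 >].

Fact frac_rel_equiv : equiv_class_of frac_rel.
Proof.
split=> [p|p q|q p r /asboolP pq /asboolP qr]; first exact/asboolP.
  by apply/asboolP/asboolP => ->.
apply/asboolP; apply: (@mulI (q.1 * q.2)).
have -> : q.1 * q.2 * (p.1 * r.2) = p.1 * q.2 * (q.1 * r.2).
  by rewrite mulACA (mulC q.1) mulACA.
by rewrite pq qr mulACA (mulC p.2) mulACA.
Qed.

Canonical frac_rel_canonical := EquivRelPack frac_rel_equiv.

Definition fraction_group : Type := {eq_quot frac_rel}.
HB.instance Definition _ := Choice.on fraction_group.
HB.instance Definition _ := Quotient.on fraction_group.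
HB.instance Definition _ := EqQuotient.on fraction_group.

Definition frac a b : fraction_group := \pi_fraction_group (a, b).

Lemma frac_eq a b c d : frac a b = frac c d <-> a * d = c * b.
Proof.
by split=> [/eqmodP/asboolP//|abcd]; apply/eqmodP/asboolP.
Qed.

Lemma fracP (g : fraction_group) : exists a b, g = frac a b.
Proof. by exists (repr g).1, (repr g).2; rewrite /frac -surjective_pairing reprK. Qed.

Definition frac_mul (g h : fraction_group) : fraction_group :=
  frac ((repr g).1 * (repr h).1) ((repr g).2 * (repr h).2).
Definition frac_inv (g : fraction_group) : fraction_group := frac (repr g).2 (repr g).1.

Lemma repr_frac a b : (repr (frac a b)).1 * b = a * (repr (frac a b)).2.
Proof. by apply/frac_eq; rewrite /frac -surjective_pairing reprK. Qed.

Lemma frac_mulE a b c d : frac_mul (frac a b) (frac c d) = frac (a * c) (b * d).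
Proof.
by apply/frac_eq; rewrite mulACA !repr_frac mulACA.
Qed.

Lemma frac_invE a b : frac_inv (frac a b) = frac b a.
Proof. by apply/frac_eq; rewrite mulC -repr_frac mulC. Qed.

Lemma frac_xx a b : frac a a = frac b b.
Proof. by apply/frac_eq; rewrite mulC. Qed.

Let u : S := projT1 (cid (@semigroup_nonempty S)).
Definition frac_one := frac u u.

Fact frac_mulA : associative frac_mul.
Proof.
move=> g h k; have [a [b ->]] := fracP g; have [c [d ->]] := fracP h.
by have [x [y ->]] := fracP k; rewrite !frac_mulE !mulgA.
Qed.
Lemma frac_mulC : commutative frac_mul.
Proof.
move=> g h; have [a [b ->]] := fracP g; have [c [d ->]] := fracP h.
by rewrite !frac_mulE (mulC a) (mulC b).
Qed.
Fact frac_mul1g : left_id frac_one frac_mul.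
Proof.
move=> g; have [a [b ->]] := fracP g; rewrite frac_mulE; apply/frac_eq.
by rewrite mulgA (mulC a).
Qed.
Fact frac_mulg1 : right_id frac_one frac_mul.
Proof. by move=> g; rewrite frac_mulC frac_mul1g. Qed.
Fact frac_mulVg : left_inverse frac_one frac_inv frac_mul.
Proof.
move=> g; have [a [b ->]] := fracP g; rewrite frac_invE frac_mulE.
by rewrite (mulC b); apply: frac_xx.
Qed.
Fact frac_mulgV : right_inverse frac_one frac_inv frac_mul.
Proof. by move=> g; rewrite frac_mulC frac_mulVg. Qed.

HB.instance Definition _ := isGroup.Build fraction_group
  frac_mulA frac_mul1g frac_mulg1 frac_mulVg frac_mulgV.

Lemma fraction_mulC (g h : fraction_group) : g * h = h * g.
Proof. exact: frac_mulC. Qed.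

(** The final topology for the maps x |-> x / a.  All translations of the group
    are continuous for it by construction. *)
Definition frac_open (O : set fraction_group) :=
  forall a, open [set x | O (frac x a)].

Fact frac_openT : frac_open setT.
Proof. by move=> a; exact: openT. Qed.
Fact frac_openI : setI_closed frac_open.
Proof. by move=> A B oA oB a; apply: openI; [exact: oA|exact: oB]. Qed.
Fact frac_open_bigU (I : Type) (f : I -> set fraction_group) :
  (forall i, frac_open (f i)) -> frac_open (\bigcup_i f i).
Proof.
by move=> of_ a; apply: (@bigcup_open _ _ _ (fun i x => f i (frac x a))) => i _;
  apply: of_.
Qed.
HB.instance Definition _ :=
  isOpenTopological.Build fraction_group frac_openT frac_openI frac_open_bigU.

Lemma frac_openP (O : set fraction_group) :
  open O <-> forall a, open [set x | O (frac x a)].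
Proof. by []. Qed.

Lemma frac_shift_open (g : fraction_group) (O : set fraction_group) :
  open O -> open [set h | O (g * h)].
Proof.
move=> /frac_openP oO; have [a [b ->]] := fracP g; apply/frac_openP => e.
rewrite [X in open X](_ : _ = (fun x => a * x) @^-1` [set x | O (frac x (b * e))]).
  by apply: open_comp (oO _) => x _; exact: mulg_left_continuous.
by rewrite predeqE => x /=; rewrite [_ * _]frac_mulE.
Qed.

Lemma nbhs_frac_shift (g h : fraction_group) (O : set fraction_group) :
  nbhs (g * h) O -> nbhs h [set k | O (g * k)].
Proof.
rewrite nbhsE => -[B [oB Bgh] BO].
apply: (@filterS _ _ _ [set k | B (g * k)]); first by move=> k /BO.
by apply: open_nbhs_nbhs; split=> //; exact: frac_shift_open.
Qed.

(** Multiplying by the fixed element u stands in for the unit that S may lack. *)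
Definition to_frac x : fraction_group := frac (x * u) u.

Lemma frac_to_frac a b : frac a b = to_frac a * (to_frac b)^-1.
Proof.
rewrite [_^-1]frac_invE [_ * _]frac_mulE; apply/frac_eq.
by rewrite -!mulgA (mulC b).
Qed.

Lemma to_fracM : {morph to_frac : x y / x * y}.
Proof.
move=> x y; rewrite [_ * _ in RHS]frac_mulE; apply/frac_eq.
by rewrite mulACA -!mulgA.
Qed.

Lemma to_frac_inj : injective to_frac.
Proof.
move=> x y /frac_eq; rewrite -!mulgA => xy; apply: (@mulI (u * u)).
by rewrite !(mulC (u * u)).
Qed.

Lemma to_frac_continuous : continuous to_frac.
Proof.
apply/continuousP => O /frac_openP oO.
by apply: open_comp (oO u) => x _; exact: mulg_right_continuous.
Qed.

(** The image of U has the shift U a as its preimage under x |-> x / a: this is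
    where open shifts are used. *)
Lemma to_frac_open (U : set S) : open U -> open (to_frac @` U).
Proof.
move=> oU; apply/frac_openP => a; rewrite [X in open X](_ : _ = [set x * a | x in U]).
  by apply: (proj2 (los_shifts hS a oU)).
rewrite predeqE => x /=; split=> -[y Uy e]; exists y => //.
  move/frac_eq: e; rewrite -!mulgA (mulC u) !mulgA => e.
  by apply: (@mulI u); rewrite !(mulC u).
by apply/frac_eq; rewrite -e -!mulgA (mulC u).
Qed.

Lemma nbhs_to_frac x (U : set S) : nbhs x U -> nbhs (to_frac x) (to_frac @` U).
Proof.
rewrite nbhsE => -[B [oB Bx] BU]; apply: (@filterS _ _ _ (to_frac @` B)).
  exact: image_subset.
by apply: open_nbhs_nbhs; split; [exact: to_frac_open|exists x].
Qed.

Fact frac_nonempty : [set: fraction_group] !=set0.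
Proof. by exists 1. Qed.

Fact frac_mul_continuous :
  continuous (fun p : fraction_group * fraction_group => p.1 * p.2).
Proof.
move=> [g h] O /= Ogh.
have [a [b gE]] := fracP g; have [c [d hE]] := fracP h.
rewrite !frac_to_frac in gE hE.
have mulgAC (x y z t : fraction_group) : (x * y) * (z * t) = (x * z) * (y * t).
  exact: (mulgACA_commutative fraction_mulC).
have ghE : g * h = ((to_frac b)^-1 * (to_frac d)^-1) * to_frac (a * c).
  by rewrite gE hE to_fracM mulgAC [RHS]fraction_mulC.
move: Ogh; rewrite ghE => /nbhs_frac_shift/to_frac_continuous/nbhs_mulg.
move=> [U [V [Ua Vc UV]]].
exists ([set k | (to_frac @` U) (to_frac b * k)],
        [set k | (to_frac @` V) (to_frac d * k)]) => /=.
  split.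
    apply: (@nbhs_frac_shift _ _ (to_frac @` U)).
    by rewrite gE fraction_mulC mulgVK; exact: nbhs_to_frac.
  apply: (@nbhs_frac_shift _ _ (to_frac @` V)).
  by rewrite hE fraction_mulC mulgVK; exact: nbhs_to_frac.
move=> [g' h'] /= [[x Ux xE] [y Vy yE]].
have := UV _ _ Ux Vy; rewrite /= to_fracM xE yE mulgAC.
have -> : (to_frac b)^-1 * (to_frac d)^-1 = (to_frac b * to_frac d)^-1.
  by rewrite invgM fraction_mulC.
by rewrite mulKg.
Qed.
HB.instance Definition _ :=
  isTopologicalSemigroup.Build fraction_group
    frac_nonempty frac_mul_continuous.


(** Every element is moved into the open set S by a translation from S, which
    reduces separation in the group to separation in S. *)
Lemma to_frac_shift g : exists a, exists b, to_frac a * g = to_frac b.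
Proof.
have [a [b ->]] := fracP g; exists b, a.
by rewrite frac_to_frac fraction_mulC mulgVK.
Qed.

Lemma frac_hausdorff : hausdorff_space fraction_group.
Proof.
move=> g h clgh.
have [a [b gE]] := to_frac_shift g; have [c [d hE]] := to_frac_shift h.
pose k := to_frac (a * c).
have kg : k * g = to_frac (c * b).
  by rewrite /k (mulC a) !to_fracM -mulgA gE.
have kh : k * h = to_frac (a * d) by rewrite /k !to_fracM -mulgA hE.
suff cbad : c * b = a * d by apply: (@mulgI _ k); rewrite kg kh cbad.
apply: (los_hausdorff hS) => U V Ucb Vad.
have [| |z [[x Ux xE] [y Vy yE]]] := clgh
    [set k' | (to_frac @` U) (k * k')] [set k' | (to_frac @` V) (k * k')].
- by apply: (@nbhs_frac_shift _ _ (to_frac @` U)); rewrite kg; exact: nbhs_to_frac.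
- by apply: (@nbhs_frac_shift _ _ (to_frac @` V)); rewrite kh; exact: nbhs_to_frac.
exists x; split=> //; suff -> : x = y by [].
by apply: to_frac_inj; rewrite xE yE.
Qed.

Lemma frac_compact_nbhs :
  exists2 C : set fraction_group, compact C & nbhs (1 : fraction_group) C.
Proof.
have [C /= + [cC _]] := @los_lcompact _ hS u I.
rewrite withinE => -[V Vu]; rewrite !setIT => CV.
have Cu : nbhs u C by rewrite CV.
exists [set k | (to_frac @` C) (to_frac u * k)].
  rewrite [X in compact X](_ : _ = (fun k => (to_frac u)^-1 * k) @` (to_frac @` C)).
    apply: continuous_compact.
      by apply: continuous_subspaceT; exact: mulg_left_continuous.
    apply: continuous_compact => //.
    by apply: continuous_subspaceT; exact: to_frac_continuous.
  rewrite predeqE => k; split=> [Ck|[y Cy <-]/=]; last by rewrite mulVKg.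
  by exists (to_frac u * k) => //; rewrite mulKg.
by apply: (@nbhs_frac_shift _ _ (to_frac @` C)); rewrite mulg1; exact: nbhs_to_frac.
Qed.

Fact frac_inv_continuous : continuous (fun g : fraction_group => g^-1).
Proof.
have [C cC C1] := frac_compact_nbhs.
by apply: (inverse_continuous (@mul1g fraction_group) (@mulg1 fraction_group)
  (@mulVg fraction_group) (@mulgV fraction_group) frac_hausdorff cC C1).
Qed.
HB.instance Definition _ :=
  isTopologicalGroup.Build fraction_group frac_inv_continuous.
End Fractions.

(** * Closures of subsemigroups *)

Lemma compact_set_type (T : topologicalType) (A : set T) :
  compact A -> compact [set: set_type A].
Proof.
move=> cA F PF _.
have [p [Ap clp]] : A `&` cluster (set_val @ F) !=set0.
  apply: cA; suff : F (set_val @^-1` A) by [].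
  by apply: filterE => x; exact: set_valP.
exists (SigSub (mem_set Ap)); split=> // B N FB [_ [[W oW <-] /= Wp WN]].
have [||_ [[y By <-] Wy]] := clp (set_val @` B) W.
- suff : F (set_val @^-1` (set_val @` B)) by [].
  by apply: filterS FB => y By; exists y.
- exact: open_nbhs_nbhs.
by exists y; split=> //; exact: WN.
Qed.

Lemma hausdorff_set_type (T : topologicalType) (A : set T) :
  hausdorff_space T -> hausdorff_space (set_type A).
Proof.
move=> hT p q clpq; apply: val_inj; apply: hT => U V Up Vq.
have cval : continuous (set_val : set_type A -> T) by exact: initial_continuous.
by have [z [Uz Vz]] := clpq _ _ (cval p U Up) (cval q V Vq); exists (set_val z).
Qed.

Section ImageSubsemigroup.
Variables (S T : topologicalSemigroupType) (f : S -> T).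
Hypothesis fM : {morph f : x y / x * y}.

Fact image_nonempty (K : subsemigroup S) : f @` subsemigroup_set K !=set0.
Proof. by have [x Kx] := subsemigroup_nonempty K; exists (f x), x. Qed.

Fact image_mul (K : subsemigroup S) x y :
  (f @` subsemigroup_set K) x -> (f @` subsemigroup_set K) y ->
  (f @` subsemigroup_set K) (x * y).
Proof.
move=> [a Ka <-] [b Kb <-]; exists (a * b); last exact: fM.
exact: subsemigroup_mul.
Qed.

Definition image_subsemigroup (K : subsemigroup S) : subsemigroup T :=
  Subsemigroup (image_nonempty K) (@image_mul K).
End ImageSubsemigroup.

Lemma compact_subsemigroup_subgroup (G : topologicalGroupType) (C : subsemigroup G) :
  compact C -> closed C -> exists H : subgroup_of G, subgroup_subsemigroup H = C.
Proof.
move=> cC clC.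
have CV := compact_subsemigroup_inv cC clC (@subsemigroup_mul G C).
have C1 : subsemigroup_set C 1.
  have [x Cx] := subsemigroup_nonempty C.
  by rewrite -(mulgV x); apply: subsemigroup_mul => //; exact: CV.
by exists (SubgroupOf C1 CV).
Qed.

Theorem corollary3p9 (R : realType) (S : topologicalSemigroupType)
    (S_comm : forall x y : S, x * y = y * x)
    (S_cancel : cancellative S)
    (S_lcompact : locally_compact [set: S])
    (S_pseudocompact : pseudocompact R S)
    (S_hausdorff : hausdorff_space S)
    (S_shifts : open_shifts S)
    (K : subsemigroup S) :
  exists (G : topologicalGroupType) (j : closure_subsemigroup K -> G),
    [/\ compact [set: G] /\ hausdorff_space G,
        {morph j : x y / x * y},
        homeo_onto_image j &
        open (range j) /\ dense (range j)].
Proof.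
have hS := LcOpenShift S_comm S_cancel S_shifts S_hausdorff S_lcompact.
pose i : S -> fraction_group hS := @to_frac S hS.
have crS := @locally_compact_completely_regular S R S_lcompact S_hausdorff.
have [C cC C1] := frac_compact_nbhs hS.
have hG := @frac_hausdorff S hS.
have ic : continuous i := @to_frac_continuous S hS.
have cS := pseudocompact_image_precompact crS S_pseudocompact ic hG cC C1.
pose L := closure_subsemigroup (image_subsemigroup (@to_fracM S hS) K).
have cL : compact L.
  apply: subclosed_compact cS _; first exact: closed_closure.
  by apply: closureS => _ [x _ <-]; exists x.
have [H HL] := compact_subsemigroup_subgroup cL (@closed_closure _ _).
have HE g : subsemigroup_set (subgroup_subsemigroup H) g ->
    closure (i @` subsemigroup_set K) g by rewrite HL.
have iH x : closure K x -> subsemigroup_set (subgroup_subsemigroup H) (i x).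
  rewrite HL => Kx W /ic /Kx[y [Ky Wy]]; by exists (i y); split=> //; exists y.
have Hi x : subsemigroup_set (subgroup_subsemigroup H) (i x) -> closure K x.
  rewrite HL => ix W /(@nbhs_to_frac S hS) /ix[_ [[y Ky <-] [z Wz]]].
  by move/to_frac_inj => zy; exists y; split=> //; rewrite -zy.
(* iH and Hi together say that the closure of K in S is the trace of H. *)
pose j (x : closure_subsemigroup K) : set_type H :=
  SigSub (mem_set (iH _ (set_valP x))).
have jopen U : open U -> open (j @` U).
  move=> [V oV <-]; exists (i @` V); first exact: to_frac_open.
  rewrite predeqE => h; split=> [[x Vx xh]|[x Vx <-]]; last by exists (set_val x).
  have Kx : closure K x by apply: Hi; rewrite xh; exact: set_valP.
  by exists (SigSub (mem_set Kx)) => //; apply: val_inj.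
exists (set_type H), j; split.
- split; last exact: hausdorff_set_type.
  by apply: compact_set_type; rewrite HL.
- by move=> x y; apply: val_inj; exact: to_fracM.
- split.
  + by move=> x y /(congr1 val)/to_frac_inj/val_inj.
  + apply: continuous_comp_initial => x.
    apply: (@continuous_comp _ _ _ set_val i); last exact: ic.
    exact: initial_continuous.
  + by move=> U oU; apply: open_subspaceW; exact: jopen.
split; first by apply: jopen; exact: openT.
move=> O [h /= Oh] [V oV VO].
have : closure (i @` subsemigroup_set K) (set_val h).
  exact: HE (set_valP h).
have Vh : V (set_val h) by move: Oh; rewrite -VO.
move=> /(_ V (open_nbhs_nbhs (conj oV Vh)))[_ [[x Kx <-] Vx]].
have Kx' : closure K x by exact: subset_closure.
by exists (j (SigSub (mem_set Kx'))); split; [rewrite -VO|exists (SigSub (mem_set Kx'))].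
Qed.
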